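(* Let $K$ be a field, $S=K[x_1,\ldots,x_n]$, and let $I\subset S$ be a graded ideal. Let $p=\operatorname{proj\,dim} S/I$ and assume $p\geq 1$. Then $$t_p(I)\leq t_{p-1}(I)+t_1(I).$$
   Context: $S=K[x_1,\ldots,x_n]$ is the polynomial ring over a field $K$ with the standard grading ($\deg x_i=1$). For the graded minimal free $S$-resolution $\mathbb{F}$ of $S/I$ write $\mathbb{F}_a=\bigoplus_j S(-j)^{b_{aj}}$ and set $t_a(I)=\max\{j : b_{aj}\neq 0\}$, the maximal degree of a homogeneous basis element of $\mathbb{F}_a$. Indexing: $\mathbb{F}$ resolves $S/I$, so $\mathbb{F}_0=S$ (for $I$ proper) and $t_1(I)$ is the maximal degree of a minimal homogeneous generator of $I$. *)

(* Defs.v *)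
From HB Require Import structures.
From mathcomp Require Import all_boot all_order all_algebra.
From mathcomp Require Import ring_quotient.
From mathcomp Require Import mpoly.

Set Implicit Arguments.
Unset Strict Implicit.
Unset Printing Implicit Defensive.

Import Order.TTheory GRing.Theory Num.Theory.
Local Open Scope ring_scope.
Local Open Scope quotient_scope.

(* The library builds V / W only as an additive group (for W : zmodClosed V)
   and, for a proper ideal, as a ring; the module structure is added here. *)
Section ModuleQuotient.
Variables (R : nzRingType) (V : lmodType R) (W : submodClosed V).

Definition submod_pred : {pred V} := W.

Lemma submod_pred_zmod : zmod_closed submod_pred.
Proof. exact: GRing.submod_closedB (submodClosedP W). Qed.

HB.instance Definition _ := GRing.isZmodClosed.Build V submod_pred
  submod_pred_zmod.

Definition modquot : Type := Quotient.quot submod_pred.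

HB.instance Definition _ := GRing.Zmodule.on modquot.
HB.instance Definition _ := EqQuotient.on modquot.

Definition mqscale (a : R) (x : modquot) : modquot := \pi_modquot (a *: repr x).

Lemma mqpiP (u v : V) : reflect (\pi_modquot u = \pi_modquot v) (u - v \in W).
Proof.
by apply: (iffP idP) => [h|/eqP]; [apply/eqP|];
   rewrite -[_ == _]/(_ == _ %[mod (Quotient.quot submod_pred)]) -Quotient.idealrBE.
Qed.

Lemma mqscale_pi a (v : V) : mqscale a (\pi_modquot v) = \pi_modquot (a *: v).
Proof.
by apply/mqpiP; rewrite -scalerBr rpredZ //; apply/mqpiP; rewrite reprK.
Qed.

Lemma mqpiD (u v : V) : \pi_modquot (u + v) = \pi_modquot u + \pi_modquot v.
Proof. exact: (raddfD (\pi_(Quotient.quot submod_pred))). Qed.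

Lemma mqscaleA a b x : mqscale a (mqscale b x) = mqscale (a * b) x.
Proof. by rewrite -[x]reprK (mqscale_pi b) !mqscale_pi scalerA. Qed.

Lemma mqscale1 : left_id 1 mqscale.
Proof. by move=> x; rewrite -[x]reprK mqscale_pi scale1r. Qed.

Lemma mqscaleDr : right_distributive mqscale +%R.
Proof.
move=> a x y; rewrite -[x]reprK -[y]reprK.
by rewrite -mqpiD !mqscale_pi scalerDr mqpiD.
Qed.

Lemma mqscaleDl (x : modquot) : {morph mqscale^~ x : a b / a + b}.
Proof.
by move=> a b; rewrite -[x]reprK !mqscale_pi scalerDl mqpiD.
Qed.

HB.instance Definition _ := GRing.Zmodule_isLmodule.Build R modquot
  mqscaleA mqscale1 mqscaleDr mqscaleDl.

End ModuleQuotient.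

Section ProjectiveDimension.
Variable R : nzRingType.

Definition projective (P : lmodType R) : Prop :=
  forall (A B : lmodType R) (g : {linear A -> B}) (f : {linear P -> B}),
    (forall b, exists a, g a = b) ->
    exists h : {linear P -> A}, forall x, g (h x) = f x.

Definition resolution (M : lmodType R) (P : nat -> lmodType R)
    (d : forall a, {linear P a.+1 -> P a}) (eps : {linear P 0%N -> M}) : Prop :=
  [/\ forall y, exists x, eps x = y,
      forall x, eps x = 0 <-> exists z, d 0%N z = x
    & forall a (x : P a.+1), d a x = 0 <-> exists z, d a.+1 z = x].

Definition projdim_le (M : lmodType R) (q : nat) : Prop :=
  exists (P : nat -> lmodType R) (d : forall a, {linear P a.+1 -> P a})
         (eps : {linear P 0%N -> M}),
    [/\ resolution d eps,
        forall a, projective (P a)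
      & forall a, (q < a)%N -> forall x : P a, x = 0].

(* Fails for every p when M has no finite projective resolution; the zero
   module gets dimension 0. *)
Definition projdim (M : lmodType R) (p : nat) : Prop :=
  projdim_le M p /\ forall q, projdim_le M q -> (p <= q)%N.

End ProjectiveDimension.

(* S as a module over itself: its default module structure is the one over K. *)
Notation regmod K n := ({mpoly K[n]}^o) (only parsing).

Section GradedResolutions.
Variables (K : fieldType) (n : nat).
Local Notation S := {mpoly K[n]}.

(* Degrees are integers, as shifts S(-j) make sense for all j in Z; only the
   zero polynomial is homogeneous of negative degree. *)
Definition zhomog (j : int) (f : S) : Prop :=
  forall m, m \in msupp f -> (mdeg m)%:Z = j.

Definition graded_ideal (I : submodClosed (regmod K n)) : Prop :=
  forall (f : S) (d : nat), f \in I -> pihomog mdeg d f \in I.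

Definition quotmod (I : submodClosed (regmod K n)) : lmodType S := modquot I.

(* A row vector v stands for the element of \bigoplus_i S(-e i) with
   coordinates v 0 i: its i-th basis vector has degree e i. *)
Definition ghomog r (e : 'I_r -> int) (j : int) (v : 'rV[S]_r) : Prop :=
  forall i, zhomog (j - e i) (v 0 i).

Record gfree_complex (I : submodClosed (regmod K n)) := GFreeComplex {
  rank : nat -> nat;
  shift : forall a, 'I_(rank a) -> int;
  gfree := fun a => ('rV[S]_(rank a) : lmodType S);
  diff : forall a, {linear gfree a.+1 -> gfree a};
  aug : {linear gfree 0%N -> quotmod I}
}.

Definition minimal_graded_resolution (I : submodClosed (regmod K n))
    (F : gfree_complex I) : Prop :=
  [/\ resolution (diff F) (aug F),
      forall a j v, ghomog (@shift I F a.+1) j v ->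
                    ghomog (@shift I F a) j (diff F a v),
      forall j v, ghomog (@shift I F 0%N) j v ->
                  exists2 f : S, zhomog j f & aug F v = \pi_(modquot I) f
      (* minimality: the image of F_(a+1) lies in (x_1, ..., x_n) F_a *)
    & forall a v i, (diff F a v 0 i)@_0%MM = 0].

Definition betti (I : submodClosed (regmod K n)) (F : gfree_complex I)
    (a : nat) (j : int) : nat :=
  #|[set i | @shift I F a i == j]|.

(* The maximum of the j with betti F a j != 0 (see maxshiftP); the value is 0
   in the degenerate case where F_a = 0. *)
Definition maxshift (I : submodClosed (regmod K n)) (F : gfree_complex I)
    (a : nat) : int :=
  let s := codom (@shift I F a) in \big[Num.max/head 0 s]_(j <- s) j.

Lemma betti_neq0 (I : submodClosed (regmod K n)) (F : gfree_complex I) a j :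
  (betti F a j != 0%N) = (j \in codom (@shift I F a)).
Proof.
rewrite /betti cards_eq0; apply/set0Pn/codomP => -[i].
  by rewrite inE => /eqP <-; exists i.
by move=> ->; exists i; rewrite inE.
Qed.

Lemma maxshiftP (I : submodClosed (regmod K n)) (F : gfree_complex I) a j :
  betti F a j != 0%N ->
  betti F a (maxshift F a) != 0%N /\ j <= maxshift F a.
Proof.
rewrite !betti_neq0 /maxshift; set s := codom _ => js; split; last first.
  by apply: le_bigmax_seq.
case: s js => // x s _ /=; rewrite [X in X \in _]big_seq.
apply: (big_ind (fun y => y \in x :: s)) => //; first exact: mem_head.
by move=> y z ys zs; rewrite /Num.max; case: ifP.
Qed.

End GradedResolutions.

(* Main.v *)
From HB Require Import structures.
Require Import Defs.
From mathcomp Require Import all_boot all_order all_algebra.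
From mathcomp Require Import generic_quotient mpoly.
From Stdlib Require Import ClassicalEpsilon.
Set Implicit Arguments.
Unset Strict Implicit.
Unset Printing Implicit Defensive.

Import Order.TTheory GRing.Theory Num.Theory.
Local Open Scope ring_scope.

(** Write [M = S/I].  An element [g] of [I] annihilates [M], so multiplication
by [g] is a chain endomorphism of the minimal resolution [F] lifting zero and
is therefore null-homotopic ([null_homotopy]): in degree [p] it equals
[d s' + s d] with [s] going from [F_(p-1)] to [F_p] and [s'] from [F_p] to
[F_(p+1)].  Since [F_(p+1) = 0], every basis vector [e] of [F_p] satisfies
[g e = s (d e)].  Taking the coordinate at [e] writes [g] as a sum
[\sum_j v_j h_j], where [v_j] is the [j]-th coordinate of [d e], homogeneous
of degree [deg e - deg e_j].  A monomial of [g] must occur in some [v_j h_j],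
whence [deg e - deg e_j <= deg g] for that [j] ([shift_le_annihilator]).  Only
[v_j] and [g] need to be homogeneous, so the homotopy may be ungraded.

For [g] one takes a coordinate of the image in [F_0] of a basis vector of
[F_1]; minimality makes it nonzero, and makes [F_0] free of rank one on a
generator of degree zero, so that [g] has degree at most [t_1] and annihilates
[M] ([generator_annihilates]).

The projective dimension is defined through arbitrary projective resolutions,
so it has to be read off from [F].  If some projective resolution has length
[q], comparing it with [F] in both directions gives an endomorphism of [F]
homotopic to the identity and zero in degree [q+1]; by minimality both
[d s'] and [s d] vanish modulo the maximal ideal, hence [F_(q+1) = 0]
([rank_projdim_le]).  Conversely [F_p] is nonzero, because otherwise [F]
itself would be a resolution of length [p-1] ([projdim_le_rank]). *)

(** * Lifting maps from projective modules *)

(** Projectivity speaks of surjections between modules, so lifting through an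
exact sequence needs the kernel as a module in its own right. *)
Section Kernel.
Variables (R : nzRingType) (B C : lmodType R) (h : {linear B -> C}).

Definition ker_pred : {pred B} := [pred x | h x == 0].

Fact ker_submod_closed : submod_closed ker_pred.
Proof.
split=> [|a x y]; rewrite !inE ?linear0 // => /eqP hx /eqP hy.
by rewrite linearP hx hy scaler0 addr0.
Qed.

HB.instance Definition _ := GRing.isSubmodClosed.Build R B ker_pred
  ker_submod_closed.

Record kernel := Kernel { ker_val : B; _ : ker_val \in ker_pred }.
HB.instance Definition _ := [isSub for ker_val].
HB.instance Definition _ := [Choice of kernel by <:].
HB.instance Definition _ := [SubChoice_isSubLmodule of kernel by <:].

Lemma ker_corestrict (A : lmodType R) (g : {linear A -> B}) :
  (forall x, h (g x) = 0) ->
  exists g' : {linear A -> kernel}, forall x, ker_val (g' x) = g x.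
Proof.
move=> hg.
have gP x : g x \in ker_pred by rewrite inE hg.
pose g' x := Kernel (gP x).
have g'_lin : linear g' by move=> a x y; apply: val_inj; rewrite /= linearP.
pose G : {linear A -> kernel} := HB.pack g'
  (GRing.isLinear.Build R A kernel _ g' g'_lin).
by exists G.
Qed.
End Kernel.

(** Corestricting [g] to the kernel of [h] makes it surjective. *)
Lemma projective_lift (R : nzRingType) (P A B C : lmodType R)
    (g : {linear A -> B}) (h : {linear B -> C}) (f : {linear P -> B}) :
    projective P ->
    (forall y, h y = 0 <-> exists x, g x = y) ->
    (forall x, h (f x) = 0) ->
  exists k : {linear P -> A}, forall x, g (k x) = f x.
Proof.
move=> projP exact hf.
have [|g' g'E] := @ker_corestrict _ _ _ h _ g.
  by move=> x; apply/exact; exists x.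
have [f' f'E] := @ker_corestrict _ _ _ h _ f hf.
have [y|k kE] := projP _ _ g' f'.
  have /eqP/exact[x gx] := valP y.
  by exists x; apply: val_inj; rewrite /= g'E.
by exists k => x; rewrite -g'E kE f'E.
Qed.

(** * Comparison of resolutions *)

Section Comparison.
Variables (R : nzRingType) (M N : lmodType R).
Variables (P Q : nat -> lmodType R).
Variables (d : forall a, {linear P a.+1 -> P a}) (eps : {linear P 0%N -> M}).
Variables (d' : forall a, {linear Q a.+1 -> Q a}) (eps' : {linear Q 0%N -> N}).
Hypothesis projP : forall a, projective (P a).
Hypothesis resP : resolution d eps.
Hypothesis resQ : resolution d' eps'.

Let ddP a x : d a (d a.+1 x) = 0.
Proof. by have [_ _ ->] := resP; exists x. Qed.

Let epsdP x : eps (d 0%N x) = 0.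
Proof. by have [_ -> _] := resP; exists x. Qed.

Lemma boundary_lift a (T : lmodType R) (f : {linear T -> Q a}) :
    projective T -> (forall x, exists z, d' a z = f x) ->
  exists k : {linear T -> Q a.+1}, forall x, d' a (k x) = f x.
Proof.
have [_ Q0 Qa] := resQ => projT; case: a f => [|a] f fim.
  by apply: (projective_lift projT Q0) => x; apply/Q0.
by apply: (projective_lift projT (Qa a)) => x; apply/Qa.
Qed.

(** The maps are built by recursion, each one carrying the property that it
sends boundaries to boundaries; this allows the next map to be lifted. *)
Lemma comparison (mu : {linear M -> N}) :
  exists phi : forall a, {linear P a -> Q a},
    (forall x, eps' (phi 0%N x) = mu (eps x)) /\
    (forall a x, d' a (phi a.+1 x) = phi a (d a x)).
Proof.
have [surQ Q0 Qa] := resQ.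
have [phi0 phi0E] := @projP 0%N _ _ eps' (mu \o eps) surQ.
pose good a (f : {linear P a -> Q a}) := forall x, exists z, d' a z = f (d a x).
have good0 : good 0%N phi0.
  by move=> x; apply/Q0; rewrite phi0E /= epsdP linear0.
have step a (f : sig (good a)) : {f' : sig (good a.+1) |
    forall x, d' a (sval f' x) = sval f (d a x)}.
  apply: constructive_indefinite_description; case: f => f goodf /=.
  have [f' f'E] := @boundary_lift a _ (f \o d a) (@projP a.+1) goodf.
  have goodf' : good a.+1 f' by move=> x; apply/Qa; rewrite f'E /= ddP linear0.
  by exists (exist _ f' goodf').
pose phi := nat_rect (fun a => sig (good a)) (exist _ phi0 good0)
  (fun a f => sval (step a f)).
exists (fun a => sval (phi a)); split=> // a x.
exact: (svalP (step a (phi a))).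
Qed.

(** Each new component lifts [u - s d], which takes values in cycles.  The
statement pairs two consecutive components of the homotopy because that is
exactly what one degree hands to the next, so a plain induction suffices. *)
Lemma null_homotopy (u : forall a, {linear P a -> Q a}) :
    (forall x, eps' (u 0%N x) = 0) ->
    (forall a x, d' a (u a.+1 x) = u a (d a x)) ->
  forall a, exists (s : {linear P a -> Q a.+1})
                   (s' : {linear P a.+1 -> Q a.+2}),
    forall x, u a.+1 x = d' a.+1 (s' x) + s (d a x).
Proof.
move=> u0 ud; have [_ Q0 Qa] := resQ.
elim=> [|a [s [s' us]]].
  have [|s sE] := boundary_lift (f := u 0%N) (@projP 0%N).
    by move=> x; apply/Q0.
  have [|s' s'E] := boundary_lift (f := u 1%N \- (s \o d 0%N)) (@projP 1%N).
    by move=> x; apply/Qa; rewrite /= linearB ud sE subrr.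
  by exists s, s' => x; rewrite s'E /= subrK.
have [|s'' s''E] := boundary_lift (f := u a.+2 \- (s' \o d a.+1)) (@projP a.+2).
  move=> x; apply/Qa; rewrite /= linearB ud us ddP linear0 addr0.
  by rewrite subrr.
by exists s', s'' => x; rewrite s''E /= subrK.
Qed.

End Comparison.

(** * Free modules of row vectors *)

Section Free.
Variables (R : nzRingType) (r : nat).
Implicit Types (M : lmodType R) (v : 'rV[R]_r).

Lemma linear_rowE M (f : {linear 'rV[R]_r -> M}) v :
  f v = \sum_i v 0 i *: f (delta_mx 0 i).
Proof.
rewrite {1}(row_sum_delta v) linear_sum.
by apply: eq_bigr => i _; rewrite linearZ.
Qed.

Lemma free_projective : projective 'rV[R]_r.
Proof.
move=> A B g f surg.
have [a aE] := fin_all_exists (fun i => surg (f (delta_mx 0 i))).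
pose h v := \sum_i v 0 i *: a i.
have h_lin : linear h.
  move=> c v w; rewrite /h scaler_sumr -big_split; apply: eq_bigr => i _ /=.
  by rewrite !mxE scalerDl scalerA.
pose H : {linear 'rV[R]_r -> A} :=
  HB.pack h (GRing.isLinear.Build R 'rV[R]_r A _ h h_lin).
exists H => v; rewrite /= /h linear_sum linear_rowE.
by apply: eq_bigr => i _; rewrite linearZ aE.
Qed.

End Free.

(** * Minimal graded free resolutions *)

Section MinimalResolution.
Variables (K : fieldType) (n : nat) (I : submodClosed (regmod K n)).
Variables (F : gfree_complex I) (hF : minimal_graded_resolution F).
Local Open Scope quotient_scope.
Local Notation S := {mpoly K[n]}.
Local Notation sh a := (@shift K n I F a).
Local Notation e_ i := (delta_mx 0 i).

Let resF : resolution (diff F) (aug F).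
Proof. by case: hF. Qed.

Let projF a : projective (gfree F a).
Proof. exact: free_projective. Qed.

Lemma mcoeff0M (f g : S) : (f * g)@_0 = f@_0 * g@_0.
Proof. exact: (mcoeff0_is_multiplicative _ _).1. Qed.

Lemma const_coefD r (v w : 'rV[S]_r) k :
  ((v + w) 0 k)@_0 = (v 0 k)@_0 + (w 0 k)@_0.
Proof. by rewrite mxE mcoeffD. Qed.

Lemma const_coefN r (v : 'rV[S]_r) k : ((- v) 0 k)@_0 = - (v 0 k)@_0.
Proof. by rewrite mxE mcoeffN. Qed.

Lemma const_coefZ r (f : S) (v : 'rV[S]_r) k :
  ((f *: v) 0 k)@_0 = f@_0 * (v 0 k)@_0.
Proof. by rewrite mxE mcoeff0M. Qed.

(** Linear maps preserve the vectors with coordinates in the maximal ideal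
[(x_1, ..., x_n)]. *)
Lemma linear_const_coef0 r s (f : {linear 'rV[S]_r -> 'rV[S]_s})
    (v : 'rV[S]_r) :
  (forall i, (v 0 i)@_0 = 0) -> forall k, (f v 0 k)@_0 = 0.
Proof.
move=> v0 k; rewrite linear_rowE summxE raddf_sum big1 // => i _.
by rewrite mxE /= mcoeff0M v0 mul0r.
Qed.

Lemma const_coef_boundary a (v : gfree F a.+1) k : ((diff F a v) 0 k)@_0 = 0.
Proof. by case: hF => _ _ _ ->. Qed.

Lemma const_coef_cycle a (v : gfree F a.+1) k :
  diff F a v = 0 -> (v 0 k)@_0 = 0.
Proof.
by case: resF => _ _ H /H[z <-]; apply: const_coef_boundary.
Qed.

Lemma ghomog_basis r (e : 'I_r -> int) i :
  ghomog e (e i) (e_ i : 'rV[S]_r).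
Proof.
move=> k m; rewrite mxE eqxx /=; case: eqP => [->|_].
  by rewrite msupp1 inE => /eqP->; rewrite mdeg0 subrr.
by rewrite msupp0.
Qed.

Lemma const_coef_basis r (i : 'I_r) : (((e_ i : 'rV[S]_r) 0 i)@_0 : K) = 1.
Proof. by rewrite mxE !eqxx mcoeff1 eqxx. Qed.

Lemma basis_not_cycle a (i : 'I_(rank F a.+1)) : diff F a (e_ i) != 0.
Proof.
apply/eqP => /const_coef_cycle-/(_ i)/eqP.
by rewrite const_coef_basis oner_eq0.
Qed.

Lemma rank0_trivial r (v : 'rV[S]_r) : r = 0%N -> v = 0.
Proof. by move: v => + r0; rewrite r0 => v; exact: thinmx0. Qed.

(** If [F_a = 0], then all of [F_(a+1)] consists of boundaries, and no basis
vector is a boundary in a minimal resolution. *)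
Lemma rank_eq0_succ a : rank F a = 0%N -> rank F a.+1 = 0%N.
Proof.
move=> ra; case E: (rank F a.+1) => [//|r].
have i : 'I_(rank F a.+1) by rewrite E; exact: ord0.
by have := basis_not_cycle i; rewrite [diff _ _ _]rank0_trivial ?eqxx.
Qed.

Lemma rank_eq0_ge a b : (a <= b)%N -> rank F a = 0%N -> rank F b = 0%N.
Proof.
move=> /subnKC <- ra; elim: (b - a)%N => [|k IH]; first by rewrite addn0.
by rewrite addnS rank_eq0_succ.
Qed.

Lemma projdim_le_rank a : rank F a.+1 = 0%N -> projdim_le (quotmod I) a.
Proof.
move=> ra; exists (gfree F), (diff F), (aug F); split=> // b ab x.
exact/rank0_trivial/(rank_eq0_ge ab).
Qed.

(** With [P] a projective resolution of length [q], the identity of [F_(q+1)]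
factors up to homotopy through [P_(q+1) = 0]; both terms of the homotopy have
coordinates without constant term, unlike a basis vector. *)
Lemma rank_projdim_le q : projdim_le (quotmod I) q -> rank F q.+1 = 0%N.
Proof.
case=> P [d [eps [resP projP P0]]].
have [phi [phi0 phid]] := comparison projF resF resP (idfun : {linear _ -> _}).
have [psi [psi0 psid]] := comparison projP resP resF (idfun : {linear _ -> _}).
pose u a : {linear gfree F a -> gfree F a} := (psi a \o phi a) \- idfun.
have [||s [s' us]] := @null_homotopy _ _ _ _ _ _ _ _ _ projF resF resF u _ _ q.
- by move=> x; rewrite /u /= linearB psi0 /= phi0 subrr.
- by move=> a x; rewrite /u /= linearB psid phid.
case E: (rank F q.+1) => [//|r].
have i : 'I_(rank F q.+1) by rewrite E; exact: ord0.
(* constant terms of the i-th coordinates in the homotopy formula at e_i *)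
have := congr1 (fun v : 'rV[S]_(rank F q.+1) => (v 0 i)@_0) (us (e_ i)).
rewrite /u /= [phi _ _](P0 _ (ltnSn q)) linear0 sub0r const_coefD const_coefN.
rewrite const_coef_basis const_coef_boundary linear_const_coef0; last first.
  exact: const_coef_boundary.
by move/eqP; rewrite addr0 oppr_eq0 oner_eq0.
Qed.

Lemma scale_pi (f h : S) :
  f *: (\pi_(modquot I) h : quotmod I) = \pi_(modquot I) (f * h).
Proof. exact: mqscale_pi. Qed.

(** If [v] maps to the class of [1] and [e_k] to that of the form [f], then
[e_k - f v] is a boundary, so by minimality [f] has a nonzero constant term;
being homogeneous, it is a constant. *)
Lemma aug_basis (k : 'I_(rank F 0)) :
  sh 0%N k = 0 /\
  exists2 c : K, c != 0 & aug F (e_ k) = \pi_(modquot I) c%:MP.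
Proof.
case: hF => -[surF F0 _] _ hom _.
have [f homf augE] := hom _ _ (@ghomog_basis _ (sh 0%N) k).
have [v vE] := surF (\pi_(modquot I) 1).
have /F0[z zE] : aug F (e_ k - f *: v) = 0.
  by rewrite linearB linearZ_LR augE vE /= scale_pi mulr1 subrr.
have f0 : f@_0 != 0.
  apply/eqP => f0; have := const_coef_boundary z k; rewrite zE.
  rewrite const_coefD const_coefN const_coefZ f0 mul0r subr0 const_coef_basis.
  by move/eqP; rewrite oner_eq0.
have sh0 : sh 0%N k = 0.
  by rewrite -(homf 0%MM) ?mdeg0 // mcoeff_msupp.
split=> //; exists f@_0 => //; rewrite augE; congr (\pi_ _ _).
apply/mpolyP => m; rewrite mcoeffC.
case: eqP => [->|/eqP m0]; first by rewrite mulr1.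
rewrite mulr0; apply/eqP; rewrite mcoeff_eq0.
apply: contra m0 => /homf; rewrite sh0 => /eqP.
by rewrite eqz_nat mdeg_eq0 eq_sym.
Qed.

(** Two basis vectors of [F_0] map to multiples of the class of [1] by units, so
some combination of them with unit coefficients is a boundary, against
minimality. *)
Lemma rank0_uniq (k l : 'I_(rank F 0)) : k = l.
Proof.
have [_ [c c0 cE]] := aug_basis k; have [_ [b b0 bE]] := aug_basis l.
apply/eqP/negP => /negP kl; case: resF => _ F0 _.
have /F0[z zE] : aug F (b%:MP *: e_ k - c%:MP *: e_ l) = 0.
  by rewrite linearB !linearZ_LR cE bE /= scalerN !scale_pi mulrC subrr.
have := const_coef_boundary z k; rewrite zE.
rewrite const_coefD const_coefN !const_coefZ.
rewrite const_coef_basis [e_ l 0 k]mxE (negPf kl) mcoeff0 mulr0 subr0.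
by rewrite mulr1 mcoeffC eqxx mulr1 => /eqP; rewrite (negPf b0).
Qed.

(** The only coordinate [g] of [d e_i] in the free module [F_0] of rank one:
[g v] is a multiple of the boundary [d e_i] for every [v]. *)
Lemma generator_annihilates (i : 'I_(rank F 1)) :
  exists g : S, [/\ g != 0, zhomog (sh 1%N i) g
    & forall x : quotmod I, g *: x = 0].
Proof.
case: hF => -[surF F0 _] homd _ _; set w := diff F 0 (e_ i).
have [k wk] := rV0Pn _ (basis_not_cycle i).
have augw : aug F w = 0 by apply/F0; exists (e_ i).
exists (w 0 k); split=> //.
  have := homd _ _ _ (@ghomog_basis _ (sh 1%N) i) k.
  by rewrite (aug_basis k).1 subr0.
move=> x; have [v <-] := surF x.
have vwC : w 0 k *: v = v 0 k *: w.
  by apply/rowP => l; rewrite (rank0_uniq l k) !mxE mulrC.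
by rewrite -linearZ vwC linearZ_LR augw scaler0.
Qed.

(** A monomial of [g] occurs in some product [v_i h_i], so it is a multiple of a
monomial of [v_i]. *)
Lemma zhomog_sumM r (v h : 'I_r -> S) (e : 'I_r -> int) (d : int) (g : S) :
    g != 0 -> zhomog d g -> (forall i, zhomog (e i) (v i)) ->
    g = \sum_i v i * h i ->
  exists i, e i <= d.
Proof.
move=> g0 homg homv gE; set m := mlead g.
have gm : m \in msupp g by exact: mlead_supp.
have /existsP[i vh] : [exists i, m \in msupp (v i * h i)].
  apply: contraTT gm => /existsPn H.
  rewrite mcoeff_msupp gE raddf_sum big1 ?eqxx // => i _.
  exact/memN_msupp_eq0/H.
exists i; have /allpairsP[[m1 m2] /= [m1v _ mE]] := msuppM_le vh.
by rewrite -(homv i _ m1v) -(homg _ gm) mE mdegD lez_nat leq_addr.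
Qed.

(** Multiplication by [g] lifts zero on [S/I], so the homotopy gives
[g e_i = s (d e_i)] once [F_(q+2)] vanishes; the [i]-th coordinate of this
equation is compared in degree [d]. *)
Lemma shift_le_annihilator q (d : int) (g : S) :
    g != 0 -> zhomog d g -> (forall x : quotmod I, g *: x = 0) ->
    rank F q.+2 = 0%N ->
  forall i, exists j, sh q.+1 i <= sh q j + d.
Proof.
move=> g0 homg annM rank0 i.
pose u a : {linear gfree F a -> gfree F a} := *:%R g.
have [||s [s' us]] := @null_homotopy _ _ _ _ _ _ _ _ _ projF resF resF u _ _ q.
- by move=> x; rewrite /u /= linearZ_LR annM.
- by move=> a x; rewrite /u /= linearZ_LR.
have gE : g = \sum_j (diff F q (e_ i)) 0 j * (s (e_ j)) 0 i.
  transitivity ((g *: (e_ i : gfree F q.+1)) 0 i).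
    by rewrite !mxE !eqxx mulr1.
  have := us (e_ i); rewrite /u /= => ->.
  rewrite (rank0_trivial (s' _)) // linear0 add0r linear_rowE summxE.
  by apply: eq_bigr => j _; rewrite mxE.
case: hF => _ homd _ _.
have homv := homd q _ _ (@ghomog_basis _ (sh q.+1) i).
have [j] := zhomog_sumM g0 homg homv gE.
by rewrite lerBlDl; exists j.
Qed.

Lemma shift_le_maxshift a (i : 'I_(rank F a)) : sh a i <= maxshift F a.
Proof.
by have [] := @maxshiftP _ _ _ F a (sh a i) _; rewrite // betti_neq0 codom_f.
Qed.

Lemma maxshift_le a (b : int) : rank F a != 0%N ->
  (forall i, sh a i <= b) -> maxshift F a <= b.
Proof.
move=> ra le_b.
have i : 'I_(rank F a) by case: (rank F a) ra => // r _; exact: ord0.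
have [] := @maxshiftP _ _ _ F a (sh a i) _.
  by rewrite betti_neq0 codom_f.
by rewrite betti_neq0 => /codomP[k ->] _.
Qed.

End MinimalResolution.

Theorem corollary3 (K : fieldType) (n : nat) (I : submodClosed (regmod K n))
    (hI : graded_ideal I) (F : gfree_complex I)
    (hF : minimal_graded_resolution F)
    (p : nat) (hp : projdim (quotmod I) p) (hp1 : (1 <= p)%N) :
  maxshift F p <= maxshift F p.-1 + maxshift F 1%N.
Proof.
case: p hp hp1 => // q [pd_le pd_min] _ /=.
have rank_q : rank F q.+1 != 0%N.
  by apply/eqP => /(projdim_le_rank hF)/pd_min; rewrite ltnn.
have rank_1 : rank F 1 != 0%N.
  by apply: contra rank_q => /eqP/(rank_eq0_ge hF (ltn0Sn q))/eqP.
have i1 : 'I_(rank F 1) by case: (rank F 1) rank_1 => // r _; exact: ord0.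
have [g [g0 homg annM]] := generator_annihilates hF i1.
apply: maxshift_le => // i.
have rank_q1 := rank_projdim_le hF pd_le.
have [j le_ij] := shift_le_annihilator hF g0 homg annM rank_q1 i.
by apply: le_trans le_ij _; apply: lerD; exact: shift_le_maxshift.
Qed.
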